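(* Let $k$ be a positive integer. (a) If $k\notin 1+3\mathbb{Z}$, then $K_0\big(A(\mathbf{Rep}_k(\mathrm{SU}(2)),\boldsymbol 1\oplus\pi_1)\big)\cong\mathrm{Ver}_k(\mathrm{SU}(2))$ as ordered rings. (b) If $k=2n$ is even and $\pi=\boldsymbol 1\oplus\bigoplus_{j=1}^{2n}\pi_j^{\oplus 2}$, then $K_0\big(A(\mathbf{Rep}_{k}(\mathrm{SU}(2)),\pi)\big)\cong\mathrm{Ver}_{k}(\mathrm{SU}(2))$ as ordered rings. In particular, whenever $k-1\notin 3\mathbb{Z}$ or $k\in 2\mathbb{Z}$, there is an object $\pi$ in $\mathbf{Rep}_k(\mathrm{SU}(2))$ such that $K_0(A(\mathbf{Rep}_k(\mathrm{SU}(2)),\pi))$ and $\mathrm{Ver}_k(\mathrm{SU}(2))$ are isomorphic as ordered rings. Here $\mathrm{Ver}_k(\mathrm{SU}(2))$ carries the positive cone $\{x:d(x)>0\}\cup\{0\}$.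
   Context: $\mathbf{Rep}_k(\mathrm{SU}(2))$ is the braided C*-tensor category (unitary modular tensor category) of the level $k$ Wess–Zumino–Witten model for $\mathrm{SU}(2)$. Its simple objects are $\pi_0=\boldsymbol 1,\pi_1,\dots,\pi_k$, all self-conjugate, with fusion rules $\pi_i\otimes\pi_j\cong\pi_{|i-j|}\oplus\pi_{|i-j|+2}\oplus\cdots\oplus\pi_{\min(i+j,\,2k-i-j)}$. $\mathrm{Ver}_k(\mathrm{SU}(2))$ (the Verlinde ring) is its fusion ring: the free abelian group on $\pi_0,\dots,\pi_k$ with product given by the fusion rules. $d$ is the quantum dimension: the ring homomorphism $\mathrm{Ver}_k(\mathrm{SU}(2))\to\mathbb{R}$ that is positive on all $\pi_j$. For a braided C*-tensor category $\mathcal{C}$ and an object $\pi$, put $\sigma=\bar\pi\otimes\pi$; $A(\mathcal{C},\pi)$ is the unital AF-algebra $\varinjlim_n\mathrm{End}(\sigma^{\otimes n})$ with connecting maps $T\mapsto T\otimes\mathrm{id}_\sigma$. As an ordered group, $K_0(A(\mathcal{C},\pi))$ is the limit of $\cdots\to\bigoplus_{\mu\prec\sigma^{\otimes n}}\mathbb{Z}\mu\to\bigoplus_{\mu\prec\sigma^{\otimes(n+1)}}\mathbb{Z}\mu\to\cdots$, where $\mu$ ranges over simple summands of $\sigma^{\otimes n}$, the connecting maps are multiplication by $\sigma$ in the fusion ring $F_{\mathcal{C}}$, and each group has the cone of non-negative coefficients. The ring structure on $K_0(A(\mathcal{C},\pi))$ is the one induced by the $*$-homomorphism $\theta\colon A(\mathcal{C},\pi)\otimes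 A(\mathcal{C},\pi)\to A(\mathcal{C},\pi)$ given on $\mathrm{End}(\sigma^{\otimes n})\otimes\mathrm{End}(\sigma^{\otimes n})$ by $T_1\otimes T_2\mapsto U_n(T_1\otimes T_2)U_n^*\in\mathrm{End}(\sigma^{\otimes 2n})$, where $U_1=\mathrm{id}$, $U_{n+1}=\mathrm{id}_\sigma\otimes(c_{\sigma,\sigma}^{\otimes n}U_n)\otimes\mathrm{id}_\sigma$ and $c$ is the braiding; concretely, the product of the class of $\mu$ at stage $n$ and the class of $\nu$ at stage $n$ is the class of $\mu\cdot\nu\in F_{\mathcal{C}}$ at stage $2n$, so $\mu$ at stage $n$ $\mapsto\mu/\sigma^n$ is an injective ring homomorphism into the localization $F_{\mathcal{C}}[\sigma^{-1}]$. An ordered ring is a commutative unital ring $R$ with a subset $R_+$ satisfying $R_++R_+\subset R_+$, $R_+\cap(-R_+)=\{0\}$, $R=R_+-R_+$, $R_+\cdot R_+\subset R_+$, and such that $1$ is an order unit; isomorphisms of ordered rings are ring isomorphisms mapping positive cone onto positive cone. *)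

(* Defs.v *)
From HB Require Import structures.
From mathcomp Require Import all_boot all_order all_algebra.
From mathcomp Require Import generic_quotient.
From mathcomp Require Import boolp classical_sets reals trigo.
From mathcomp Require Import zify ring lra.

Set Implicit Arguments.
Unset Strict Implicit.
Unset Printing Implicit Defensive.

Import Order.TTheory GRing.Theory Num.Theory.

Local Open Scope ring_scope.
Local Open Scope quotient_scope.
Local Open Scope classical_set_scope.

(** * Ordered rings *)

Record ordered_ring (A : comPzRingType) (P : set A) : Prop := OrderedRing {
  ordered_ringD : forall x y, P x -> P y -> P (x + y);
  ordered_ring_anti : forall x, P x /\ P (- x) <-> x = 0;
  ordered_ring_gen : forall x, exists y z, [/\ P y, P z & x = y - z];
  ordered_ringM : forall x y, P x -> P y -> P (x * y);
  ordered_ring_unit : P 1 /\ forall x, exists n : nat, P (n%:R - x)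
}.

(* Being isomorphic "as ordered rings" includes that both sides are ordered
   rings. *)
Definition ordered_ring_isomorphic (A B : comPzRingType)
    (P : set A) (Q : set B) : Prop :=
  [/\ ordered_ring P, ordered_ring Q &
      exists2 f : {rmorphism A -> B}, bijective f & f @` P = Q].

(** * Fusion rules of a braided C*-tensor category with finitely many simples *)

(* [fusion i j l] is the multiplicity of the simple [l] in [i (x) j];
   commutativity comes from the braiding. *)
Record fusion_rules := FusionRules {
  simple : finType;
  unit_simple : simple;
  dual : simple -> simple;
  fusion : simple -> simple -> simple -> nat;
  fusion1 : forall i j, fusion unit_simple i j = (i == j);
  fusionC : forall i j l, fusion i j l = fusion j i l;
  fusionA : forall i j l p,
    (\sum_m fusion i j m * fusion m l p = \sum_m fusion j l m * fusion i m p)%N;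
  fusion_dual : forall i j, fusion i j unit_simple = (j == dual i)
}.

Section FusionRing.
Variable C : fusion_rules.
Implicit Types (i j l : simple C).

(* The isomorphism class of an object, given by the multiplicities of the
   simples; the direct sum is the pointwise addition. *)
Definition object := {ffun simple C -> nat}.

HB.instance Definition _ := GRing.Nmodule.on object.

Definition simple_object i : object := [ffun j => (j == i) : nat].

Definition dual_object (p : object) : object := [ffun j => p (dual j)].

(* The carrier is not used directly as a ring because finite functions already
   bear the pointwise product. *)
Definition fusion_ring := {ffun simple C -> int}.

HB.instance Definition _ := GRing.Zmodule.on fusion_ring.

Implicit Types (x y z : fusion_ring).

Definition class (p : object) : fusion_ring := [ffun i => (p i)%:Z].

Definition fusion_one : fusion_ring := class (simple_object (unit_simple C)).

Definition fusion_mul x y : fusion_ring :=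
  [ffun l => \sum_i \sum_j x i * y j * (fusion i j l)%:Z].

Fact fusion_mulC : commutative fusion_mul.
Proof.
move=> x y; apply/ffunP => l; rewrite !ffunE exchange_big /=.
apply: eq_bigr => i _; apply: eq_bigr => j _.
by rewrite fusionC [x j * _]mulrC.
Qed.

Fact fusion_mul1 : left_id fusion_one fusion_mul.
Proof.
move=> x; apply/ffunP => l; rewrite !ffunE (bigD1 (unit_simple C)) //=.
rewrite [X in _ + X]big1 => [|i /negPf ni]; last first.
  by apply: big1 => j _; rewrite !ffunE ni !mul0r.
rewrite addr0 (bigD1 l) //= big1 => [|j /negPf nj]; last first.
  by rewrite fusion1 nj mulr0.
by rewrite !ffunE fusion1 !eqxx mul1r mulr1 addr0.
Qed.

Fact fusion_mulDl : left_distributive fusion_mul +%R.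
Proof.
move=> x y z; apply/ffunP => l; rewrite !ffunE -big_split /=.
apply: eq_bigr => i _; rewrite -big_split /=; apply: eq_bigr => j _.
by rewrite ffunE !mulrDl.
Qed.

Fact fusion_mulA : associative fusion_mul.
Proof.
move=> x y z; apply/ffunP => p; rewrite !ffunE.
transitivity (\sum_i \sum_j \sum_l
    x i * y j * z l * (\sum_m fusion j l m * fusion i m p)%:Z).
  apply: eq_bigr => i _; under eq_bigr => m _.
    rewrite ffunE mulr_sumr mulr_suml.
    under eq_bigr => j _ do rewrite mulr_sumr mulr_suml.
    over.
  rewrite exchange_big /=; apply: eq_bigr => j _.
  rewrite exchange_big /=; apply: eq_bigr => l _.
  rewrite -natz natr_sum mulr_sumr; apply: eq_bigr => m _.
  by rewrite natz PoszM; ring.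
symmetry; under eq_bigr => m _.
  under eq_bigr => l _.
    rewrite ffunE !mulr_suml.
    under eq_bigr => i _ do rewrite !mulr_suml.
    over.
  over.
rewrite exchange_big /=.
under eq_bigr => l _.
  rewrite exchange_big /=.
  under eq_bigr => i _ do rewrite exchange_big /=.
  over.
rewrite exchange_big /=; apply: eq_bigr => i _.
rewrite exchange_big /=; apply: eq_bigr => j _; apply: eq_bigr => l _.
rewrite -fusionA -natz natr_sum mulr_sumr; apply: eq_bigr => m _.
by rewrite natz PoszM; ring.
Qed.

Fact fusion_one_neq0 : fusion_one != 0.
Proof. by apply/eqP => /ffunP/(_ (unit_simple C)); rewrite !ffunE eqxx. Qed.

HB.instance Definition _ := GRing.Zmodule_isComNzRing.Build fusion_ring
  fusion_mulA fusion_mulC fusion_mul1 fusion_mulDl fusion_one_neq0.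

Definition nonneg x : bool := [forall i, 0 <= x i].

Lemma fusion_mulE x y l : (x * y) l = \sum_i \sum_j x i * y j * (fusion i j l)%:Z.
Proof. by rewrite [LHS]ffunE. Qed.

Lemma nonneg_mul x y : nonneg x -> nonneg y -> nonneg (x * y).
Proof.
move=> /forallP x0 /forallP y0; apply/forallP => l; rewrite fusion_mulE.
by apply: sumr_ge0 => i _; apply: sumr_ge0 => j _; rewrite !mulr_ge0.
Qed.

Lemma nonneg_add x y : nonneg x -> nonneg y -> nonneg (x + y).
Proof.
by move=> /forallP x0 /forallP y0; apply/forallP => l; rewrite ffunE addr_ge0.
Qed.

Lemma nonneg_class (p : object) : nonneg (class p).
Proof. by apply/forallP => i; rewrite ffunE. Qed.

Lemma nonneg_exp x n : nonneg x -> nonneg (x ^+ n).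
Proof.
move=> x0; elim: n => [|n IHn]; first exact: nonneg_class.
by rewrite exprS nonneg_mul.
Qed.

End FusionRing.

Arguments simple_object {C} i.

(** * The ordered ring K_0(A(C, pi)) *)

(* A(C, pi) is the limit of the finite-dimensional C*-algebras End(sigma^n)
   along T |-> T (x) id_sigma.  K_0 commutes with this limit,
   K_0(End(sigma^n)) is the free abelian group on the simple summands of
   sigma^n with its cone of non-negative elements, and the connecting maps
   induce the multiplication by sigma: the ordered group K_0(A(C, pi)) is
   defined below as the limit of that system.  It thus depends on C only
   through its fusion rules. *)

Section K0.
Variables (C : fusion_rules) (p : object C).

(* The class of sigma = dual(pi) (x) pi. *)
Definition sigma : fusion_ring C := class (dual_object p) * class p.

Definition in_stage (n : nat) (x : fusion_ring C) : bool :=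
  [forall i, (x i != 0) ==> ((sigma ^+ n) i != 0)].

(* An element of K_0(End(sigma^n)), for some n: the free abelian group on the
   simple summands of sigma^n. *)
Definition staged := {a : nat * fusion_ring C | in_stage a.1 a.2}.

Implicit Types a b c : staged.

Definition stage a : nat := (val a).1.
Definition elt a : fusion_ring C := (val a).2.

Definition Staged n x (h : in_stage n x) : staged :=
  exist (fun a : nat * fusion_ring C => in_stage a.1 a.2) (n, x) h.

(* Equality in the inductive limit along the multiplication by sigma. *)
Definition eventually_equal : rel staged := fun a b =>
  `[< exists N, [/\ (stage a <= N)%N, (stage b <= N)%N &
      sigma ^+ (N - stage a) * elt a = sigma ^+ (N - stage b) * elt b] >].

Lemma nonneg_sigma : nonneg sigma.
Proof. by rewrite nonneg_mul ?nonneg_class. Qed.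

Lemma nonneg_sigmaX n : nonneg (sigma ^+ n).
Proof. exact: nonneg_exp nonneg_sigma. Qed.

Lemma in_stageM n m x y :
  in_stage n x -> in_stage m y -> in_stage (n + m) (x * y).
Proof.
move=> /forallP hx /forallP hy; apply/forallP => l; apply/implyP.
apply: contra_neq => s0; rewrite fusion_mulE.
have /forallP s1 := nonneg_sigmaX n; have /forallP s2 := nonneg_sigmaX m.
apply: big1 => i _; apply: big1 => j _; apply/eqP.
move: s0; rewrite exprD fusion_mulE => /eqP.
rewrite psumr_eq0 => [|i' _]; last first.
  by apply: sumr_ge0 => j' _; rewrite !mulr_ge0.
move=> /allP/(_ i (mem_index_enum _))/=.
rewrite psumr_eq0 => [|j' _]; last by rewrite !mulr_ge0.
move=> /allP/(_ j (mem_index_enum _))/=.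
rewrite !mulf_eq0 => /orP[/orP[s0|s0]|->]; last by rewrite orbT.
  by have := hx i; rewrite s0 implybF negbK => ->.
by have := hy j; rewrite s0 implybF negbK => ->; rewrite orbT.
Qed.

Lemma in_stageX n : in_stage n (sigma ^+ n).
Proof. by apply/forallP => i; apply/implyP. Qed.

Lemma in_stageD n x y : in_stage n x -> in_stage n y -> in_stage n (x + y).
Proof.
move=> /forallP hx /forallP hy; apply/forallP => l; apply/implyP.
apply: contra_neq => s0; have := hx l; have := hy l; rewrite s0 eqxx !implybF.
by rewrite ffunE !negbK => /eqP -> /eqP ->.
Qed.

Lemma in_stageN n x : in_stage n x -> in_stage n (- x).
Proof.
move=> /forallP hx; apply/forallP => l; have := hx l.
by rewrite ffunE oppr_eq0.
Qed.

Lemma in_stage0 : in_stage 0 0.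
Proof. by apply/forallP => i; rewrite ffunE eqxx. Qed.

Lemma in_stage1 : in_stage 0 1.
Proof. exact: (in_stageX 0). Qed.

Lemma eventually_equalP a b : reflect
  (exists N, sigma ^+ (N + stage b) * elt a = sigma ^+ (N + stage a) * elt b)
  (eventually_equal a b).
Proof.
apply: (iffP (asboolP _)) => [[N [aN bN e]]|[N e]].
  exists N; move: e => /(congr1 ( *%R (sigma ^+ (stage a + stage b)))).
  rewrite !mulrA -!exprD.
  have -> : (stage a + stage b + (N - stage a) = N + stage b)%N by lia.
  by have -> : (stage a + stage b + (N - stage b) = N + stage a)%N by lia.
exists (N + stage a + stage b)%N; split; [lia | lia |].
have -> : (N + stage a + stage b - stage a = N + stage b)%N by lia.
by have -> : (N + stage a + stage b - stage b = N + stage a)%N by lia.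
Qed.

Lemma eventually_equal_equiv : equiv_class_of eventually_equal.
Proof.
split=> [a|a b|b a c].
- by apply/eventually_equalP; exists 0%N.
- by apply/eventually_equalP/eventually_equalP => -[N e]; exists N.
- move=> /eventually_equalP[N e] /eventually_equalP[M f].
  apply/eventually_equalP; exists (N + M + stage b)%N.
  rewrite (_ : (_ + stage c = (M + stage c) + (N + stage b))%N); last lia.
  rewrite exprD -mulrA e mulrCA f mulrA -exprD.
  by congr (sigma ^+ _ * _); lia.
Qed.

Canonical eventually_equal_equivRel := EquivRelPack eventually_equal_equiv.

Definition K0 := {eq_quot eventually_equal}.

HB.instance Definition _ := Choice.on K0.
HB.instance Definition _ := EqQuotient.on K0.

Definition add_staged a b : staged :=
  Staged (in_stageD (in_stageM (valP a) (in_stageX (stage b)))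
                    (in_stageM (in_stageX (stage a)) (valP b))).

Definition opp_staged a : staged := Staged (in_stageN (valP a)).

(* mu at stage n times nu at stage m is mu * nu at stage n + m; for n = m this
   is the map induced on K_0 by theta on End(sigma^n) (x) End(sigma^n). *)
Definition mul_staged a b : staged := Staged (in_stageM (valP a) (valP b)).

Lemma K0P a b : reflect
  (exists N, sigma ^+ (N + stage b) * elt a = sigma ^+ (N + stage a) * elt b)
  (\pi_K0 a == \pi_K0 b).
Proof. by rewrite piE; apply: eventually_equalP. Qed.

Lemma K0_eq a b : 
  sigma ^+ stage b * elt a = sigma ^+ stage a * elt b -> \pi_K0 a = \pi_K0 b.
Proof. by move=> e; apply/eqP/K0P; exists 0%N; rewrite !add0n. Qed.

Definition K0_add := lift_op2 K0 add_staged.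
Definition K0_opp := lift_op1 K0 opp_staged.
Definition K0_mul := lift_op2 K0 mul_staged.
Definition K0_zero : K0 := \pi_K0 (Staged in_stage0).
Definition K0_one : K0 := \pi_K0 (Staged in_stage1).

Lemma pi_K0_opp : {morph \pi_K0 : a / opp_staged a >-> K0_opp a}.
Proof.
move=> a; unlock K0_opp; apply/eqP/K0P.
have /K0P[N e] : \pi_K0 a == \pi_K0 (repr (\pi_K0 a)) by rewrite reprK.
by exists N; rewrite /elt /= !mulrN e.
Qed.

Lemma pi_K0_add : {morph \pi_K0 : a b / add_staged a b >-> K0_add a b}.
Proof.
move=> a b; unlock K0_add; apply/eqP/K0P.
have /K0P[N e] : \pi_K0 a == \pi_K0 (repr (\pi_K0 a)) by rewrite reprK.
have /K0P[M f] : \pi_K0 b == \pi_K0 (repr (\pi_K0 b)) by rewrite reprK.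
move: (repr (\pi_K0 a)) (repr (\pi_K0 b)) e f => a' b' e f.
exists (N + M)%N; rewrite /add_staged /elt /stage /= -!/(elt _) -!/(stage _).
transitivity (sigma ^+ (M + stage b' + stage b) * (sigma ^+ (N + stage a') * elt a)
  + sigma ^+ (N + stage a' + stage a) * (sigma ^+ (M + stage b') * elt b)).
  by rewrite !exprD; ring.
by rewrite e f !exprD; ring.
Qed.

Lemma pi_K0_mul : {morph \pi_K0 : a b / mul_staged a b >-> K0_mul a b}.
Proof.
move=> a b; unlock K0_mul; apply/eqP/K0P.
have /K0P[N e] : \pi_K0 a == \pi_K0 (repr (\pi_K0 a)) by rewrite reprK.
have /K0P[M f] : \pi_K0 b == \pi_K0 (repr (\pi_K0 b)) by rewrite reprK.
move: (repr (\pi_K0 a)) (repr (\pi_K0 b)) e f => a' b' e f.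
exists (N + M)%N; rewrite /mul_staged /elt /stage /= -!/(elt _) -!/(stage _).
transitivity
  ((sigma ^+ (N + stage a') * elt a) * (sigma ^+ (M + stage b') * elt b)).
  by rewrite !exprD; ring.
by rewrite e f !exprD; ring.
Qed.

Canonical pi_K0_opp_morph := PiMorph1 pi_K0_opp.
Canonical pi_K0_add_morph := PiMorph2 pi_K0_add.
Canonical pi_K0_mul_morph := PiMorph2 pi_K0_mul.

Local Ltac K0_solve := apply: K0_eq; rewrite /elt /stage /= ?exprD; ring.

Fact K0_addA : associative K0_add.
Proof.
by elim/quotW=> a; elim/quotW=> b; elim/quotW=> c; rewrite !piE; K0_solve.
Qed.

Fact K0_addC : commutative K0_add.
Proof. by elim/quotW=> a; elim/quotW=> b; rewrite !piE; K0_solve. Qed.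

Fact K0_add0 : left_id K0_zero K0_add.
Proof. by elim/quotW=> a; rewrite /K0_zero !piE; K0_solve. Qed.

Fact K0_addN : left_inverse K0_zero K0_opp K0_add.
Proof. by elim/quotW=> a; rewrite /K0_zero !piE; K0_solve. Qed.

HB.instance Definition _ :=
  GRing.isZmodule.Build K0 K0_addA K0_addC K0_add0 K0_addN.

Fact K0_mulA : associative K0_mul.
Proof.
by elim/quotW=> a; elim/quotW=> b; elim/quotW=> c; rewrite !piE; K0_solve.
Qed.

Fact K0_mulC : commutative K0_mul.
Proof. by elim/quotW=> a; elim/quotW=> b; rewrite !piE; K0_solve. Qed.

Fact K0_mul1 : left_id K0_one K0_mul.
Proof. by elim/quotW=> a; rewrite /K0_one !piE; K0_solve. Qed.

Fact K0_mulDl : left_distributive K0_mul K0_add.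
Proof.
by elim/quotW=> a; elim/quotW=> b; elim/quotW=> c; rewrite !piE; K0_solve.
Qed.

HB.instance Definition _ :=
  GRing.Zmodule_isComPzRing.Build K0 K0_mulA K0_mulC K0_mul1 K0_mulDl.

Lemma K0_addE a b : \pi_K0 a + \pi_K0 b = \pi_K0 (add_staged a b).
Proof. by rewrite [RHS]pi_K0_add. Qed.

Lemma K0_oppE a : - \pi_K0 a = \pi_K0 (opp_staged a).
Proof. by rewrite [RHS]pi_K0_opp. Qed.

Lemma K0_mulE a b : \pi_K0 a * \pi_K0 b = \pi_K0 (mul_staged a b).
Proof. by rewrite [RHS]pi_K0_mul. Qed.

Definition K0_pos : set K0 := [set \pi_K0 a | a in [set a | nonneg (elt a)]].

End K0.

Arguments K0_pos : clear implicits.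

(** * Rep_k(SU(2)) and its Verlinde ring *)

(* [l] is one of |i - j|, |i - j| + 2, ..., min (i + j) (2k - i - j). *)
Definition su2_admissible (k i j l : nat) : bool :=
  [&& maxn i j - minn i j <= l, l <= minn (i + j) (2 * k - (i + j))
    & ~~ odd (i + j + l)]%N.

Section SU2Admissible.
Local Open Scope nat_scope.

Lemma even_double (n : nat) : ~~ odd n -> exists h, n = (h + h)%N.
Proof. by move=> /even_halfK <-; exists n./2; rewrite addnn. Qed.

Lemma distnE_maxmin (u v : nat) : maxn u v - minn u v = (u - v) + (v - u).
Proof. by case: (leqP u v) => uv; rewrite ?(maxn_idPr uv) ?(minn_idPl uv) ?(maxn_idPl (ltnW uv)) ?(minn_idPr (ltnW uv)); lia. Qed.

Lemma su2_admissibleE (k i j l : nat) : i <= k -> j <= k ->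
  su2_admissible k i j l = [&& [&& i <= j + l, j <= i + l, l <= i + j &
                             i + j + l <= 2 * k] & ~~ odd (i + j + l)].
Proof.
move=> ik jk; rewrite /su2_admissible leq_min distnE_maxmin -!andbA andbA !andbA; congr (_ && _).
by apply/idP/idP => /andP[/andP[? ?] ?]; lia.
Qed.

Lemma su2_admissibleC k i j l : su2_admissible k i j l = su2_admissible k j i l.
Proof. by rewrite /su2_admissible maxnC minnC addnC. Qed.

Lemma su2_dist (i j l p : nat) : exists a, 
    [/\ (i <= j + a)%N, (j <= i + a)%N, (l <= p + a)%N, (p <= l + a)%N &
        [\/ i = (j + a)%N, j = (i + a)%N, l = (p + a)%N | p = (l + a)%N]].
Proof.
have : exists a, [/\ (i <= j + a)%N, (j <= i + a)%N & i = j + a \/ j = i + a].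
  by case: (leqP i j) => h; [exists (j-i)|exists (i-j)]; split; lia.
have : exists a, [/\ (l <= p + a)%N, (p <= l + a)%N & l = p + a \/ p = l + a].
  by case: (leqP l p) => h; [exists (p-l)|exists (l-p)]; split; lia.
move=> [c [c1 c2 c3]] [a [a1 a2 a3]].
case: (leqP c a) => ac; [exists a|exists c]; split; try lia.
  by case: a3; [constructor 1|constructor 2].
by case: c3; [constructor 3|constructor 4].
Qed.

Lemma su2_admissible_shift (k i j l p a b x : nat) : i <= k -> j <= k -> l <= k -> p <= k ->
    [/\ (i <= j + a)%N, (j <= i + a)%N, (l <= p + a)%N, (p <= l + a)%N &
        [\/ i = (j + a)%N, j = (i + a)%N, l = (p + a)%N | p = (l + a)%N]] ->
    [/\ (j <= l + b)%N, (l <= j + b)%N, (i <= p + b)%N, (p <= i + b)%N &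
        [\/ j = (l + b)%N, l = (j + b)%N, i = (p + b)%N | p = (i + b)%N]] ->
  x <= k -> su2_admissible k i j x && su2_admissible k x l p ->
  [/\ (a <= x)%N, x - a + b <= k & su2_admissible k j l (x - a + b) && su2_admissible k i (x - a + b) p].
Proof.
move=> ik jk lk pk [a1 a2 a3 a4 ea] [b1 b2 b3 b4 eb] xk.
move=> /andP[]; rewrite (su2_admissibleE _ ik jk) (su2_admissibleE _ xk lk).
move=> /andP[/and4P[h1 h2 h3 h4] /even_double[h e]] /andP[/and4P[g1 g2 g3 g4] /even_double[g f]].
have ax : a <= x by case: ea => ?; lia.
have [y ey] : exists y, x = a + y by exists (x - a); lia.
rewrite ey addKn; rewrite ey in h1 h2 h3 h4 e g1 g2 g3 g4 f ax xk.
have [z ez] : exists z, y = z + z.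
  case: ea => E; [exists (h - i) | exists (h - j) | exists (g - l)|exists (g - p)]; lia.
have [z' ez'] : exists z, j + l + b = z + z.
  case: eb => E; [exists j|exists l|exists (h + g + b - a - y - i)|exists (h + g + b - a - y - p)]; lia.
have [z'' ez''] : exists z, i + p + b = z + z.
  exists (h + g + z' - a - y - j - l); lia.
have yb : y + b <= k by case: ea => ?; case: eb => ?; lia.
split; [exact: leq_addr | exact: yb | rewrite !su2_admissibleE //]; apply/andP; split; apply/andP; split.
- by apply/and4P; split; case: ea => ?; case: eb => ?; lia.
- by rewrite (_ : _ + _ = (z' + z).*2) ?odd_double //; lia.
- by apply/and4P; split; case: ea => ?; case: eb => ?; lia.
- by rewrite (_ : _ + _ = (z'' + z).*2) ?odd_double //; lia.
Qed.

End SU2Admissible.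

Section SU2.
Variable k : nat.
Implicit Types i j l m p : 'I_k.+1.

Definition su2_fusion i j l : nat := su2_admissible k i j l.

Fact su2_fusion1 i j : su2_fusion ord0 i j = (i == j).
Proof.
rewrite /su2_fusion su2_admissibleE ?leq_ord // -val_eqE add0n.
congr nat_of_bool; apply/idP/eqP => [/andP[/and4P[_ ij ji _] _]|/= ->].
  by apply/eqP; rewrite eqn_leq ij ji.
by rewrite leqnn addnn odd_double mul2n leq_double leq_ord.
Qed.

Fact su2_fusionC i j l : su2_fusion i j l = su2_fusion j i l.
Proof. by rewrite /su2_fusion su2_admissibleC. Qed.

Fact su2_fusionA i j l p :
  (\sum_m su2_fusion i j m * su2_fusion m l p =
   \sum_m su2_fusion j l m * su2_fusion i m p)%N.
Proof.
have ik := ltn_ord i; have jk := ltn_ord j.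
have lk := ltn_ord l; have pk := ltn_ord p.
(* Both sides count integers of a given parity in intervals of equal length. *)
have [a da] := su2_dist i j l p; have [b db] := su2_dist j l i p.
under eq_bigr do rewrite mulnb; under [RHS]eq_bigr do rewrite mulnb.
rewrite -!big_mkcond !sum1_card.
pose P (x : nat) := su2_admissible k i j x && su2_admissible k x l p.
pose Q (x : nat) := su2_admissible k j l x && su2_admissible k i x p.
have PQ (m : 'I_k.+1) : P m -> [/\ a <= m, m - a + b < k.+1 & Q (m - a + b)]%N.
  by move=> Pm; apply: su2_admissible_shift da db _ Pm; rewrite -ltnS.
have QP (m : 'I_k.+1) : Q m -> [/\ b <= m, m - b + a < k.+1 & P (m - b + a)]%N.
  rewrite /Q /P ![su2_admissible _ j _ _]su2_admissibleC [X in _ && X]su2_admissibleC => Qm.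
  have := @su2_admissible_shift k l j i p b a m.
  rewrite ![su2_admissible _ l _ p]su2_admissibleC ![su2_admissible _ j i _]su2_admissibleC.
  apply; rewrite ?leq_ord //.
    by case: db => ? ? ? ? [] ?; split=> //; [constructor 2|constructor 1|constructor 3|constructor 4].
  by case: da => ? ? ? ? [] ?; split=> //; [constructor 2|constructor 1|constructor 3|constructor 4].
apply/eqP; rewrite eqn_leq; apply/andP; split.
  rewrite -(card_in_imset (f := fun m : 'I_k.+1 => inord (m - a + b) : 'I_k.+1)).
    apply: subset_leq_card; apply/fintype.subsetP => _ /finset.imsetP[m Pm ->].
    by have [_ mk Qm] := PQ m Pm; rewrite -[_ \in _]/(Q _) inordK.
  move=> m n Pm Pn /(congr1 val); have [am mk _] := PQ m Pm.
  have [an nk _] := PQ n Pn.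
  by rewrite /= !inordK // => /addIn e; apply: val_inj; rewrite /= -(subnK am) e subnK.
rewrite -(card_in_imset (f := fun m : 'I_k.+1 => inord (m - b + a) : 'I_k.+1)).
  apply: subset_leq_card; apply/fintype.subsetP => _ /finset.imsetP[m Qm ->].
  by have [_ mk Pm] := QP m Qm; rewrite -[_ \in _]/(P _) inordK.
move=> m n Qm Qn /(congr1 val); have [am mk _] := QP m Qm.
have [an nk _] := QP n Qn.
by rewrite /= !inordK // => /addIn e; apply: val_inj; rewrite /= -(subnK am) e subnK.
Qed.

Fact su2_fusion_dual i j : su2_fusion i j ord0 = (j == i).
Proof.
rewrite /su2_fusion su2_admissibleE ?leq_ord // -val_eqE /= !addn0.
congr nat_of_bool; apply/idP/eqP => [/andP[/and3P[ij ji _] _]|->].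
  by apply/eqP; rewrite eqn_leq ij ji.
by rewrite leqnn addnn odd_double mul2n leq_double leq_ord.
Qed.

Definition su2_rules : fusion_rules := @FusionRules 'I_k.+1 ord0 id su2_fusion
  su2_fusion1 su2_fusionC su2_fusionA su2_fusion_dual.

Definition Ver := fusion_ring su2_rules.

HB.instance Definition _ := GRing.ComNzRing.on Ver.

(* The object pi_j, for j <= k. *)
Definition irr (j : nat) : object su2_rules := @simple_object su2_rules (inord j).

End SU2.

Arguments irr {k} j.

Section QuantumDimension.
Variables (k : nat) (R : realType).

(* The classes of the simples are the [class (irr j)]. Such a [d] is unique by
   Frobenius reciprocity, and exists by [quantum_dimension_exists]. *)
Definition quantum_dimension (d : {rmorphism Ver k -> R}) : Prop :=
  forall j : nat, (j <= k)%N -> 0 < d (class (irr j)).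

Definition Ver_pos (d : {rmorphism Ver k -> R}) : set (Ver k) :=
  [set x | 0 < d x \/ x = 0].

Let t : R := pi / k.+2%:R.

Lemma sin_qdim_gt0 (j : nat) : (j <= k)%N -> 0 < sin (j.+1%:R * t).
Proof.
move=> jk; apply: sin_gt0_pi; rewrite mulr_gt0 ?divr_gt0 ?pi_gt0 //=.
by rewrite /t mulrCA gtr_pMr ?pi_gt0 // ltr_pdivrMr // mul1r ltr_nat; lia.
Qed.

Lemma sum_step2 (f : nat -> R) (n a r : nat) : (a + r.*2 < n)%N ->
  \sum_(0 <= l < n | [&& a <= l, l <= a + r.*2 & ~~ odd (a + l)]%N) f l =
  \sum_(0 <= m < r.+1) f (a + m.*2)%N.
Proof.
elim: r => [|r IHr] arn.
  rewrite big_nat1 (big_rem a) ?mem_index_iota /=; last by rewrite -[a]addn0.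
  rewrite addnn odd_double addn0 !leqnn /= big_seq_cond big1 ?addr0 // => l.
  rewrite mem_rem_uniq ?iota_uniq // inE /= => /andP[/andP[la _] /and3P[al la' _]].
  by move: la; rewrite eqn_leq al la'.
rewrite big_nat_recr //= -IHr; last by lia.
rewrite big_mkcond /= (bigD1_seq (a + r.+1.*2)%N) ?mem_index_iota ?iota_uniq //=.
rewrite -big_mkcondr leq_addr leqnn addnA addnn oddD !odd_double /= addrC.
congr (_ + _); apply: eq_bigl => l.
by apply/andP/and3P => [[? /and3P[? ? ?]]|[? ? ?]];
  (split; last try by apply/and3P; split; lia); lia.
Qed.

Lemma qdim_fusion (i j : nat) : (i <= k)%N -> (j <= k)%N ->
  sin (i.+1%:R * t) * sin (j.+1%:R * t) =
  sin t * \sum_(l < k.+1) (su2_admissible k i j l)%:R * sin (l.+1%:R * t).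
Proof.
move=> ik jk; pose c (n : nat) := cos (n%:R * t).
have cE (l : nat) : 2 * (sin t * sin (l.+1%:R * t)) = c l - c l.+2.
  rewrite /c (_ : l%:R * t = l.+1%:R * t - t); last by rewrite -natr1; ring.
  rewrite (_ : l.+2%:R * t = l.+1%:R * t + t); last by rewrite -[l.+2%:R]natr1; ring.
  by rewrite cosB cosD; ring.
pose a := ((i - j) + (j - i))%N.
pose r := minn (minn i j) (minn (k - i) (k - j)).
have ark : (a + r.*2 < k.+1)%N by rewrite /a /r; case: (leqP i j); lia.
have sumE : \sum_(l < k.+1) (su2_admissible k i j l)%:R * (c l - c l.+2) =
    c a - c (a + r.*2).+2.
  rewrite -(big_mkord xpredT (fun l => (su2_admissible k i j l)%:R * (c l - c l.+2))).
  transitivity (\sum_(0 <= l < k.+1 | [&& a <= l, l <= a + r.*2 & ~~ odd (a + l)]%N) (c l - c l.+2)).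
    rewrite [RHS]big_mkcond /=; apply: eq_bigr => l _.
    rewrite -[RHS]mul1r; rewrite (_ : su2_admissible k i j l = [&& a <= l, l <= a + r.*2 & ~~ odd (a + l)]%N); first by case: ifP => _; rewrite ?mul1r ?mul0r ?mulr0.
    rewrite su2_admissibleE // /a /r; apply/andP/and3P; case: (leqP i j) => ij.
    - by move=> [/and4P[? ? ? ?] ?]; split; lia.
    - by move=> [/and4P[? ? ? ?] ?]; split; lia.
    - by move=> [? ? ?]; split; first (apply/and4P; split); lia.
    - by move=> [? ? ?]; split; first (apply/and4P; split); lia.
  rewrite sum_step2 //.
  transitivity (\sum_(0 <= m < r.+1) (- c (a + m.+1.*2)%N - - c (a + m.*2)%N)).
    by apply: eq_bigr => m _; rewrite opprK addrC doubleS !addnS.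
  by rewrite telescope_sumr // addn0 opprK addrC doubleS !addnS.
have two0 : (2 : R) != 0 by rewrite pnatr_eq0.
apply: (mulfI two0).
rewrite mulr_sumr mulr_sumr.
under eq_bigr => l _ do rewrite [sin t * _]mulrCA [2 * _]mulrCA cE.
rewrite sumE.
have -> : c a = cos (i.+1%:R * t - j.+1%:R * t).
  rewrite /c /a -mulrBl; case: (leqP i j) => ij.
    by rewrite -[RHS]cosN -mulNr opprB -natrB // subSS (_ : _ + _ = j - i)%N //; lia.
  by rewrite -natrB ?ltnS 1?ltnW // subSS (_ : _ + _ = i - j)%N //; lia.
have -> : c (a + r.*2).+2 = cos (i.+1%:R * t + j.+1%:R * t).
  rewrite /c -mulrDl -natrD; have [ijk|ijk] := leqP (i + j) k.
    by rewrite (_ : (a + r.*2).+2 = (i.+1 + j.+1))%N // /a /r; case: (leqP i j); lia.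
  have e : ((a + r.*2).+2 + (i.+1 + j.+1) = 2 * k.+2)%N.
    by rewrite /a /r; case: (leqP i j); lia.
  have -> : (a + r.*2).+2%:R * t = - ((i.+1 + j.+1)%:R * t) + pi *+ 2.
    have : ((a + r.*2).+2 + (i.+1 + j.+1))%:R * t = pi *+ 2.
      by rewrite e /t natrM -mulrA [k.+2%:R * _]mulrC divfK ?pnatr_eq0 // mulr_natl.
    by rewrite natrD => <-; ring.
  by rewrite cosD2pi cosN.
by rewrite cosB cosD; ring.
Qed.

Definition sin_dim (x : Ver k) : R :=
  \sum_(j < k.+1) (x j)%:~R * (sin (j.+1%:R * t) / sin t).

Lemma sin_t_gt0 : 0 < sin t.
Proof. by have := sin_qdim_gt0 (leq0n k); rewrite mul1r. Qed.

Fact sin_dim_zmod : zmod_morphism sin_dim.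
Proof.
move=> x y; rewrite /sin_dim -sumrB; apply: eq_bigr => j _.
by rewrite !ffunE intrD mulrNz mulrDl mulNr.
Qed.

Lemma sin_dim_class j : (j <= k)%N ->
  sin_dim (class (irr j)) = sin (j.+1%:R * t) / sin t.
Proof.
move=> jk; rewrite /sin_dim (bigD1 (inord j)) //= big1 => [|i /negPf ij].
  by rewrite !ffunE eqxx mul1r addr0 inordK.
by rewrite !ffunE ij mul0r.
Qed.

Fact sin_dim_monoid : monoid_morphism sin_dim.
Proof.
have t0 : sin t != 0 by rewrite gt_eqF ?sin_t_gt0.
split.
  have -> : 1 = class (irr 0) :> Ver k.
    by congr (class (simple_object _)); apply: val_inj; rewrite /= inordK.
  by rewrite sin_dim_class // mul1r divff.
move=> x y; rewrite /sin_dim mulr_suml.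
transitivity (\sum_(i < k.+1) \sum_(j < k.+1) \sum_(l < k.+1)
   (x i)%:~R * (y j)%:~R * (su2_admissible k i j l)%:R * (sin (l.+1%:R * t) / sin t)).
  under eq_bigr => l _.
    rewrite fusion_mulE rmorph_sum mulr_suml.
    under eq_bigr => i _ do rewrite rmorph_sum mulr_suml.
    over.
  rewrite exchange_big /=; apply: eq_bigr => i _.
  rewrite exchange_big /=; apply: eq_bigr => j _; apply: eq_bigr => l _.
  by rewrite !rmorphM.
apply: eq_bigr => i _; rewrite mulr_sumr; apply: eq_bigr => j _.
transitivity ((x i)%:~R * (y j)%:~R *
    (sin (i.+1%:R * t) * sin (j.+1%:R * t)) / sin t ^+ 2); last by field.
rewrite qdim_fusion ?leq_ord // !mulr_sumr mulr_suml.
by apply: eq_bigr => l _; field.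
Qed.

HB.instance Definition _ := GRing.isZmodMorphism.Build _ _ sin_dim sin_dim_zmod.
HB.instance Definition _ :=
  GRing.isMonoidMorphism.Build _ _ sin_dim sin_dim_monoid.

Lemma quantum_dimension_exists :
  exists d : {rmorphism Ver k -> R}, quantum_dimension d.
Proof.
exists sin_dim => j jk.
by rewrite -[X in 0 < X]/(sin_dim _) sin_dim_class // divr_gt0 ?sin_qdim_gt0 ?sin_t_gt0.
Qed.

End QuantumDimension.

(* Main.v *)
(**
  Let [d] be a character of a fusion ring that is positive on the simples, and
  let [sigma] be invertible in the fusion ring, with a strictly positive power
  [t].  Sending [x] at stage [n] to [x / sigma^n] identifies [K_0] with the
  fusion ring.  It remains to see that [d x > 0] makes [t^n x] strictly
  positive for large [n], as Perron-Frobenius theory predicts: multiplication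
  by [t] has the positive left and right eigenvectors [d i] and [d (dual i)],
  and it contracts the kernel of the left one by a factor smaller than [d t].

  For SU(2) all objects are self-dual, so [sigma = pi^2] and it suffices to
  invert [pi].  When [3] does not divide [k - 1], the inverse of [1 + pi_1] is
  a telescoping sum.  When [k] is even, let [E] and [O] be the sums of the even
  and of the odd simples: [pi_1 E = 2 O], [pi_1 O = 2 E - 1 - pi_k] and
  [pi_k E = E] give [2 (E^2 - O^2) = 2 E], so [2 (E + O) - 1] has the inverse
  [2 (E - O) - 1].
*)

Require Import Defs.
From HB Require Import structures.
From mathcomp Require Import all_boot all_order all_algebra.
From mathcomp Require Import generic_quotient.
From mathcomp Require Import boolp classical_sets reals.
From mathcomp Require Import zify ring lra.

Set Implicit Arguments.
Unset Strict Implicit.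
Unset Printing Implicit Defensive.

Import Order.TTheory GRing.Theory Num.Theory.

Local Open Scope ring_scope.
Local Open Scope quotient_scope.

(** * Preliminaries: comparison of geometric sequences and transport of order *)

Lemma geometric_domination (R : archiRealFieldType) (q t c e : R) :
  0 <= q -> q < t -> 0 < e ->
  exists N, forall n, (N <= n)%N -> q ^+ n * c < t ^+ n * e.
Proof.
move=> q0 qt e0; have t0 : 0 < t by apply: le_lt_trans qt.
pose h := t - q; have h0 : 0 < h by rewrite subr_gt0.
(* A form of Bernoulli's inequality free of division by [q], which may be 0. *)
have bern n : q ^+ n * (t + n%:R * h) <= t ^+ n.+1.
  elim: n => [|n IHn]; first by rewrite expr0 mul0r mul1r addr0 expr1.
  rewrite [t ^+ _]exprS; apply: (le_trans _ (ler_wpM2l (ltW t0) IHn)).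
  rewrite -subr_ge0 (_ : _ - _ = q ^+ n * (h ^+ 2 * n.+1%:R)); last first.
    by rewrite /h exprS; ring.
  by rewrite !mulr_ge0 ?exprn_ge0 ?(ltW h0).
(* For [n >= N] this yields [c * t <= (t + n%:R * h) * (e / 2)]; halving [e] makes the final
   inequality strict. *)
have [N hN] : exists N : nat, c * t * 2 / (e * h) < N%:R.
  by exists (Num.truncn (c * t * 2 / (e * h))).+1; apply: real_truncnS_gt; apply: num_real.
exists N => n Nn; apply: (@le_lt_trans _ _ (t ^+ n * (e / 2))); last first.
  by rewrite ltr_pM2l ?exprn_gt0 // ltr_pdivrMr // ltr_pMr // ltr1n.
rewrite -(ler_pM2r t0) -[leRHS]mulrAC -exprSr.
apply: (le_trans _ (ler_wpM2r _ (bern n))); last by rewrite divr_ge0 ?ltW.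
rewrite -!mulrA ler_wpM2l ?exprn_ge0 //.
have : c * t * 2 <= n%:R * (e * h).
  rewrite -ler_pdivrMr ?mulr_gt0 //; apply: (le_trans (ltW hN)).
  by rewrite ler_nat.
have : 0 < t * e by rewrite mulr_gt0.
lra.
Qed.

(** Isomorphy includes the axioms on both sides; those of [K0] will be pulled back from the fusion
    ring. *)
Lemma isomorphic_ordered_ring (A B : comPzRingType) (P : set A) (Q : set B)
    (f : {rmorphism A -> B}) :
  bijective f -> (f @` P = Q)%classic -> ordered_ring Q -> ordered_ring P.
Proof.
move=> bij_f fPQ [QD Qanti Qgen QM [Q1 Qunit]].
have [g fK gK] := bij_f; have f_inj := bij_inj bij_f.
have PQ x : P x <-> Q (f x).
  split=> [Px|]; first by rewrite -fPQ; exists x.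
  by rewrite -fPQ => -[y Py /f_inj <-].
split.
- by move=> x y /PQ Qx /PQ Qy; apply/PQ; rewrite rmorphD; apply: QD.
- move=> x; rewrite !PQ rmorphN Qanti; split=> [fx0|->]; last exact: rmorph0.
  by apply: f_inj; rewrite fx0 rmorph0.
- move=> x; have [y [z [Qy Qz e]]] := Qgen (f x).
  exists (g y), (g z); split; [by apply/PQ; rewrite gK..|].
  by apply: f_inj; rewrite rmorphB !gK.
- by move=> x y /PQ Qx /PQ Qy; apply/PQ; rewrite rmorphM; apply: QM.
- split=> [|x]; first by apply/PQ; rewrite rmorph1.
  have [n Qn] := Qunit (f x); exists n.
  by apply/PQ; rewrite rmorphB rmorph_nat.
Qed.

(** * Fusion rings with a positive character *)

Section FusionRules.
Variable C : fusion_rules.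
Implicit Types (i j l : simple C) (x y z : fusion_ring C).

Local Notation simple_class i := (class (simple_object i)).

Lemma class_objectD (p q : object C) : class (p + q) = class p + class q.
Proof. by apply/ffunP => i; rewrite !ffunE. Qed.

Lemma class_object0 : class (0 : object C) = 0.
Proof. by apply/ffunP => i; rewrite !ffunE. Qed.

Lemma simple_classM i j l :
  (simple_class i * simple_class j) l = (fusion i j l)%:Z.
Proof.
rewrite fusion_mulE (bigD1 i) //= [X in _ + X]big1 => [|i' /negPf ni].
  rewrite addr0 (bigD1 j) //= big1 => [|j' /negPf nj].
    by rewrite !ffunE !eqxx !mul1r addr0.
  by rewrite !ffunE nj mulr0 mul0r.
by apply: big1 => j' _; rewrite !ffunE ni !mul0r.
Qed.

Lemma simple_class_decomposition x : x = \sum_i simple_class i *~ x i.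
Proof.
apply/ffunP => l; rewrite sum_ffunE (bigD1 l) //= big1 => [|i /negPf ni].
  by rewrite addr0 ffunMzE !ffunE eqxx; lia.
by rewrite ffunMzE !ffunE eq_sym ni; lia.
Qed.

Lemma dual_involutive : involutive (@dual C).
Proof.
move=> i; apply/esym/eqP.
have := fusionC i (dual i) (unit_simple C).
by rewrite !fusion_dual eqxx; case: eqP.
Qed.

(** Frobenius reciprocity: both sides count the unit in [i (x) j (x) l]. *)
Lemma fusion_rotate i j l : fusion i j (dual l) = fusion j l (dual i).
Proof.
have pick (F : simple C -> nat) a : (\sum_m F m * (m == a) = F a)%N.
  by rewrite (bigD1 a) //= eqxx muln1 big1 ?addn0 // => m /negPf->; exact: muln0.
have := fusionA i j l (unit_simple C).
under eq_bigr do rewrite [X in (_ * X)%N]fusionC fusion_dual.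
by under [in X in _ = X -> _]eq_bigr do rewrite fusion_dual; rewrite !pick.
Qed.

Definition strictly_positive x := forall i, 0 < x i.

Section Character.
Variables (R : realType) (d : {rmorphism fusion_ring C -> R}).
Hypothesis d_gt0 : forall i, 0 < d (simple_class i).

Lemma characterE x : d x = \sum_i (x i)%:~R * d (simple_class i).
Proof.
rewrite {1}[x]simple_class_decomposition rmorph_sum; apply: eq_bigr => i _.
by rewrite rmorphMz mulrzl.
Qed.

Lemma character_gt0 x : nonneg x -> x != 0 -> 0 < d x.
Proof.
move=> /forallP x0 xn0; have [i xi] : exists i, x i != 0.
  apply/existsP; apply: contra_neqT xn0; rewrite negb_exists => /forallP h.
  by apply/ffunP => i; rewrite ffunE; apply/eqP; have := h i; rewrite negbK.
rewrite characterE (bigD1 i) //= ltr_pwDl //.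
  by rewrite mulr_gt0 // ltr0z lt_def xi x0.
by apply: sumr_ge0 => j _; rewrite mulr_ge0 ?ler0z // ltW.
Qed.

Lemma character_cone_ordered_ring :
  ordered_ring [set x | 0 < d x \/ x = 0]%classic.
Proof.
have d1 : 0 < d 1 by rewrite rmorph1.
have archi (r : R) : exists n : nat, r < n%:R.
  by exists (Num.truncn r).+1; apply: real_truncnS_gt; apply: num_real.
split.
- move=> x y /= [dx|->]; last by rewrite add0r.
  move=> [dy|->]; last by rewrite addr0; left.
  by left; rewrite rmorphD addr_gt0.
- move=> x; split=> [/= [[dx|//] [|/eqP]]|->]; last by rewrite oppr0; split; right.
    by rewrite rmorphN oppr_gt0 ltNge ltW.
  by rewrite oppr_eq0 => /eqP.
- move=> x; have [n hn] := archi (1 + `|d x|).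
  have /ler_normlP[? ?] := lexx `|d x|.
  exists (n%:R + x), n%:R; rewrite /= rmorphD !rmorph_nat.
  by split; [left; lra | left; lra | rewrite addrC addKr].
- move=> x y /= [dx|->]; last by rewrite mul0r; right.
  move=> [dy|->]; last by rewrite mulr0; right.
  by left; rewrite rmorphM mulr_gt0.
- split=> [|x]; first by left.
  have [n hn] := archi (d x); exists n; left.
  by rewrite rmorphB rmorph_nat subr_gt0.
Qed.

Local Notation dim i := (d (simple_class i)).

Lemma fusion_ring_mulE x y j :
  (x * y) j = \sum_i y i * (x * simple_class i) j.
Proof.
rewrite {1}[y]simple_class_decomposition mulr_sumr sum_ffunE.
by apply: eq_bigr => i _; rewrite mulrzAr ffunMzE mulrzz mulrC.
Qed.

(** Two rotations. Duality thus transposes the matrix of the multiplication by [x], exchanging left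
    and right eigenvectors. *)
Lemma mul_simple_class_dual x i j :
  (x * simple_class i) j = (x * simple_class (dual j)) (dual i).
Proof.
have E a b : (x * simple_class a) b = \sum_l x l * (fusion l a b)%:Z.
  rewrite mulrC fusion_ring_mulE; apply: eq_bigr => l _.
  by rewrite simple_classM fusionC.
rewrite !E; apply: eq_bigr => l _; congr (_ * _%:Z).
rewrite -[j in LHS]dual_involutive [LHS]fusion_rotate [LHS]fusion_rotate.
exact: fusionC.
Qed.

Lemma mul_simple_class_gt0 x i j :
  strictly_positive x -> 0 < (x * simple_class i) j.
Proof.
move=> x0; have nn_class (a : simple C) : nonneg (simple_class a) by apply: nonneg_class.
rewrite lt_def (forallP (nonneg_mul _ (nn_class i))) ?andbT; last first.
  by apply/forallP => l; rewrite ltW.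
(* A vanishing coefficient would force [i (x) dual j] to vanish. *)
apply/eqP; rewrite mulrC fusion_ring_mulE => /eqP; rewrite psumr_eq0; last first.
  move=> l _; rewrite mulr_ge0 ?(ltW (x0 _)) //.
  exact: (forallP (nonneg_mul (nn_class i) (nn_class l))).
move=> /allP h; have : 0 < d (simple_class i * simple_class (dual j)).
  by rewrite rmorphM mulr_gt0.
suff -> : simple_class i * simple_class (dual j) = 0 by rewrite rmorph0 ltxx.
apply/ffunP => l; rewrite [RHS]ffunE -(dual_involutive l) -mul_simple_class_dual.
by have := h (dual l) (mem_index_enum _); rewrite mulf_eq0 gt_eqF ?x0 // => /eqP.
Qed.

(** * Perron-Frobenius theory of a strictly positive element *)

Section PerronFrobenius.
Variable t : fusion_ring C.
Hypothesis t_gt0 : strictly_positive t.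

(** The pairing of the left with the right eigenvector, the denominator of the spectral
    projection. *)
Let D := \sum_i dim i * dim (dual i).

Let D_gt0 : 0 < D.
Proof.
rewrite /D (bigD1 (unit_simple C)) //= ltr_pwDl ?mulr_gt0 //.
by apply: sumr_ge0 => i _; rewrite mulr_ge0 // ltW.
Qed.

(* [D] times the component of [x] annihilated by the left eigenvector [dim]
   of the multiplication by [t]; the vector [dim \o dual] is the right one. *)
Let dev x j : R := D * (x j)%:~R - d x * dim (dual j).

Lemma dim_dev x : \sum_j dim j * dev x j = 0.
Proof.
rewrite /dev; under eq_bigr do rewrite mulrBr mulrCA [dim _ * (d x * _)]mulrCA.
rewrite sumrB -!mulr_sumr [d x]characterE -/D.
under eq_bigr do rewrite mulrC.
by rewrite mulrC subrr.
Qed.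

(** Transposing turns the sum into the expansion of [d (t * simple_class (dual j))]. *)
Lemma dim_dual_eigen j :
  \sum_i ((t * simple_class i) j)%:~R * dim (dual i) = d t * dim (dual j).
Proof.
rewrite -rmorphM [RHS]characterE [RHS](reindex_inj (inv_inj dual_involutive)) /=.
by apply: eq_bigr => i _; rewrite mul_simple_class_dual.
Qed.

Lemma dev_mul x j :
  dev (t * x) j = \sum_i ((t * simple_class i) j)%:~R * dev x i.
Proof.
rewrite /dev rmorphM fusion_ring_mulE rmorph_sum mulr_sumr.
under [RHS]eq_bigr do rewrite mulrBr [_ * (d x * _)]mulrCA.
rewrite sumrB -[X in _ = _ - X]mulr_sumr dim_dual_eigen; congr (_ - _); last by ring.
by apply: eq_bigr => i _; rewrite rmorphM; ring.
Qed.

(* Subtracting a small multiple of the rank one eigenprojection leaves a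
   non-negative matrix that acts on [dev] in the same way. *)
Lemma dev_contraction : exists2 q, 0 <= q < d t & forall x c,
  (forall j, `|dev x j| <= c * dim (dual j)) ->
  forall j, `|dev (t * x) j| <= q * c * dim (dual j).
Proof.
pose M i j : R := ((t * simple_class i) j)%:~R.
have M0 i j : 0 < M i j by rewrite ltr0z mul_simple_class_gt0.
have [e e0 eM] : exists2 e, 0 < e & forall i j, e * (dim i * dim (dual j)) <= M i j.
  (* Each positive term of [S] is at most [S], so [S^-1] is a lower bound for all the inverse
     ratios. *)
  pose S := \sum_(a : simple C * simple C) dim a.1 * dim (dual a.2) / M a.1 a.2.
  have S_ge i j : dim i * dim (dual j) / M i j <= S.
    rewrite /S (bigD1 (i, j)) //= lerDl; apply: sumr_ge0 => a _.
    by rewrite divr_ge0 ?mulr_ge0 // ltW.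
  have S0 : 0 < S.
    apply: lt_le_trans (S_ge (unit_simple C) (unit_simple C)).
    by rewrite divr_gt0 ?mulr_gt0.
  exists S^-1 => [|i j]; first by rewrite invr_gt0.
  by rewrite mulrC ler_pdivrMr // [leRHS]mulrC -ler_pdivrMr.
have red j : \sum_i (M i j - e * (dim i * dim (dual j))) * dim (dual i)
    = (d t - e * D) * dim (dual j).
  under eq_bigr do rewrite mulrBl.
  rewrite sumrB dim_dual_eigen mulrBl; congr (_ - _).
  by rewrite /D mulr_sumr mulr_suml; apply: eq_bigr => i _; ring.
exists (d t - e * D).
  rewrite ltrBlDr ltrDl mulr_gt0 // andbT.
  (* By [red], this is the eigenvalue of a non-negative matrix at a positive vector. *)
  rewrite -(pmulr_lge0 _ (d_gt0 (dual (unit_simple C)))) -red.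
  by apply: sumr_ge0 => i _; rewrite mulr_ge0 ?subr_ge0 // ltW.
move=> x c hx j; rewrite dev_mul.
have -> : \sum_i ((t * simple_class i) j)%:~R * dev x i =
    \sum_i (M i j - e * (dim i * dim (dual j))) * dev x i.
  under [RHS]eq_bigr do rewrite mulrBl.
  rewrite sumrB [X in _ - X](_ : _ = 0) ?subr0 //.
  rewrite (eq_bigr (fun i => e * dim (dual j) * (dim i * dev x i))) => [|i _]; last by ring.
  by rewrite -mulr_sumr dim_dev mulr0.
rewrite mulrAC -red mulr_suml; apply: (le_trans (ler_norm_sum _ _ _)).
apply: ler_sum => i _; rewrite normrM ger0_norm ?subr_ge0 // -mulrA.
by rewrite ler_wpM2l ?subr_ge0 // mulrC.
Qed.

(** [D] times the coefficient at [j] is [d (t ^+ n * x) * dim (dual j)] plus [dev]: the former grows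
    like [d t ^+ n], the latter at most like [q ^+ n]. *)
Lemma eventually_strictly_positive x : 0 < d x ->
  exists N, forall n, (N <= n)%N -> strictly_positive (t ^+ n * x).
Proof.
move=> dx; have [q /andP[q0 qt] hq] := dev_contraction.
pose c := \sum_i `|dev x i| / dim (dual i).
have hc j : `|dev x j| <= c * dim (dual j).
  rewrite -ler_pdivrMr // /c (bigD1 j) //= lerDl.
  by apply: sumr_ge0 => i _; rewrite divr_ge0 // ltW.
have hn n j : `|dev (t ^+ n * x) j| <= q ^+ n * c * dim (dual j).
  elim: n j => [|n IHn] j; first by rewrite !expr0 !mul1r.
  by rewrite exprS -mulrA [q ^+ _]exprS -[q * _ * c]mulrA; apply: hq.
have [N hN] := geometric_domination c q0 qt dx.
exists N => n Nn j; rewrite -(ltr0z R) -(pmulr_rgt0 _ D_gt0).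
have /ler_normlP[h _] := hn n j.
have : q ^+ n * c * dim (dual j) < d t ^+ n * d x * dim (dual j).
  by rewrite ltr_pM2r // hN.
by move: h; rewrite /dev rmorphM rmorphXn; lra.
Qed.

End PerronFrobenius.

(** * Evaluation of [K0] in the fusion ring for invertible sigma *)

Section K0Isomorphism.
Variables (p : object C) (u : fusion_ring C) (m : nat).
Hypothesis sigmaV : sigma p * u = 1.
Hypothesis sigma_gt0 : strictly_positive (sigma p ^+ m).

Let sigmaXV n : sigma p ^+ n * u ^+ n = 1.
Proof. by rewrite -exprMn sigmaV expr1n. Qed.

Definition K0_eval (a : K0 p) : fusion_ring C :=
  elt (repr a) * u ^+ stage (repr a).

(** Independence of the representative: a high power of [u] cancels the powers of sigma in the limit
    relation. *)
Lemma K0_eval_pi (a : staged p) : K0_eval (\pi_(K0 p) a) = elt a * u ^+ stage a.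
Proof.
rewrite /K0_eval.
have /K0P[N] : \pi_(K0 p) (repr (\pi_(K0 p) a)) == \pi_(K0 p) a by rewrite reprK.
set b := repr _ => /(congr1 ( *%R (u ^+ (N + stage a + stage b)))) e.
have cancel_sigma (i j : nat) (x : fusion_ring C) :
    u ^+ (i + j) * (sigma p ^+ i * x) = x * u ^+ j.
  by rewrite exprD mulrACA [u ^+ i * _]mulrC sigmaXV mul1r mulrC.
rewrite cancel_sigma in e; rewrite e.
by rewrite addnAC cancel_sigma.
Qed.

Fact K0_eval_zmod : zmod_morphism K0_eval.
Proof.
move=> a b; rewrite -[a]reprK -[b]reprK; move: (repr a) (repr b) => {}a {}b.
rewrite K0_oppE K0_addE !K0_eval_pi /elt /stage /= -!/(elt _) -!/(stage _).
transitivity ((elt a * u ^+ stage a) * (sigma p ^+ stage b * u ^+ stage b) -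
  (elt b * u ^+ stage b) * (sigma p ^+ stage a * u ^+ stage a)).
  by rewrite exprD; ring.
by rewrite !sigmaXV !mulr1.
Qed.

Fact K0_eval_monoid : monoid_morphism K0_eval.
Proof.
split=> [|a b]; first by rewrite K0_eval_pi mulr1.
rewrite -[a]reprK -[b]reprK; move: (repr a) (repr b) => {}a {}b.
rewrite K0_mulE !K0_eval_pi /elt /stage /= -!/(elt _) -!/(stage _).
by rewrite exprD mulrACA.
Qed.

HB.instance Definition _ :=
  GRing.isZmodMorphism.Build (K0 p) (fusion_ring C) K0_eval K0_eval_zmod.
HB.instance Definition _ :=
  GRing.isMonoidMorphism.Build (K0 p) (fusion_ring C) K0_eval K0_eval_monoid.

Lemma in_stage_strictly_positive n x :
  strictly_positive (sigma p ^+ n) -> in_stage p n x.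
Proof.
by move=> s0; apply/forallP => i; apply/implyP => _; rewrite gt_eqF ?s0.
Qed.

Lemma K0_eval_staged n x (h : in_stage p n (sigma p ^+ n * x)) :
  K0_eval (\pi_(K0 p) (Staged h)) = x.
Proof. by rewrite K0_eval_pi /elt /stage /= mulrAC sigmaXV mul1r. Qed.

(** The inverse puts [sigma p ^+ m * x] at stage [m], where every simple occurs and the support
    condition is void. *)
Lemma K0_eval_bij : bijective K0_eval.
Proof.
have h x := in_stage_strictly_positive (sigma p ^+ m * x) sigma_gt0.
exists (fun x => \pi_(K0 p) (Staged (h x))) => [a|x]; last exact: K0_eval_staged.
rewrite -[a]reprK; move: (repr a) => {}a; rewrite K0_eval_pi.
apply: K0_eq; rewrite /elt /stage /= -!/(elt _) -!/(stage _).
by rewrite mulrCA [_ * u ^+ _]mulrC [sigma p ^+ stage a * _]mulrA sigmaXV mul1r.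
Qed.

Lemma K0_isomorphic_fusion_ring : ordered_ring_isomorphic
  (K0_pos C p) [set x | 0 < d x \/ x = 0]%classic.
Proof.
have ordQ := character_cone_ordered_ring.
have du : 0 < d u.
  have sn0 : sigma p != 0.
    by apply: contra_eq_neq sigmaV => ->; rewrite mul0r eq_sym oner_eq0.
  have ds := character_gt0 (nonneg_sigma p) sn0.
  by rewrite -(pmulr_rgt0 _ ds) -rmorphM sigmaV rmorph1.
have image : (K0_eval @` K0_pos C p = [set x | 0 < d x \/ x = 0])%classic.
  apply/seteqP; split=> [_ [_ [a a0 <-] <-]|x] /=.
    rewrite K0_eval_pi; have [->|an0] := eqVneq (elt a) 0.
      by right; rewrite mul0r.
    by left; rewrite rmorphM rmorphXn mulr_gt0 ?exprn_gt0 // character_gt0.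
  move=> [dx|->]; last first.
    exists 0; last by rewrite rmorph0.
    exists (Staged (in_stage0 p)) => //=.
    by apply/forallP => i; rewrite ffunE.
  have [N hN] := eventually_strictly_positive sigma_gt0 dx.
  have d1 : 0 < d 1 by rewrite rmorph1.
  have [N' hN'] := eventually_strictly_positive sigma_gt0 d1.
  have /hN sx0 := leq_maxl N N'; have /hN' s0 := leq_maxr N N'.
  move: sx0 s0; rewrite mulr1 -exprM => sx0 s0.
  have h := in_stage_strictly_positive (sigma p ^+ (m * maxn N N') * x) s0.
  exists (\pi_(K0 p) (Staged h)); last exact: K0_eval_staged.
  by exists (Staged h) => //; apply/forallP => i; exact: ltW.
split=> //; first exact: (isomorphic_ordered_ring K0_eval_bij image).
by exists K0_eval => //; exact: K0_eval_bij.
Qed.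

End K0Isomorphism.

End Character.

End FusionRules.

(** * The Verlinde ring of SU(2) *)

Section Verlinde.
Variable k : nat.
Hypothesis k_gt0 : (0 < k)%N.

(* [irr j] is junk for [k < j], while the relation [pi_(k+1) = 0] makes the
   recursion for the multiplication by [pi_1] uniform. *)
Definition ver (j : nat) : Ver k := if (j <= k)%N then class (irr j) else 0.

Local Notation X := (ver 1).
Local Notation g := (ver k).

Lemma verE j (l : 'I_k.+1) : ver j l = (j == l :> nat)%:Z.
Proof.
rewrite /ver; case: leqP => jk.
  by rewrite !ffunE -val_eqE /= inordK // eq_sym.
by rewrite ffunE gtn_eqF // (leq_ltn_trans _ jk) // leq_ord.
Qed.

Lemma ver0 : ver 0 = 1.
Proof. by apply/ffunP => l; rewrite verE [RHS]ffunE ffunE -val_eqE eq_sym. Qed.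

Lemma ver_gt j : (k < j)%N -> ver j = 0.
Proof. by move=> kj; rewrite /ver leqNgt kj. Qed.

Lemma verM i j (l : 'I_k.+1) : (i <= k)%N -> (j <= k)%N ->
  (ver i * ver j) l = (su2_admissible k i j l)%:Z.
Proof.
by move=> ik jk; rewrite /ver ik jk simple_classM /= /su2_fusion !inordK.
Qed.

Lemma verX_succ j : (j < k)%N -> X * ver j.+1 = ver j + ver j.+2.
Proof.
move=> jk; apply/ffunP => l; rewrite verM // ffunE !verE.
by rewrite su2_admissibleE //; have := ltn_ord l; lia.
Qed.

Lemma ver_topM j : (j <= k)%N -> g * ver j = ver (k - j).
Proof.
move=> jk; apply/ffunP => l; rewrite verM // !verE su2_admissibleE //.
by have := ltn_ord l; lia.
Qed.

(** [(1 + X) * (ver j.+1 - ver j) = ver j.+2 - ver j.-1] for [0 < j < k], so steps of three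
    telescope; in both residue classes the upper end is [ver k.+1 = 0]. *)
Lemma ver1_unit : ~~ (3 %| k%:Z - 1)%Z -> exists y, (1 + X) * y = 1.
Proof.
move=> k3; have [[m km]|[m km]] : (exists m, k = m * 3)%N \/ (exists m, k = m * 3 + 2)%N.
- have := divn_eq k 3; have := ltn_pmod k (isT : 0 < 3)%N.
  move: (k %/ 3)%N (k %% 3)%N => m [|[|[|//]]] _ e.
  + by left; exists m; rewrite e addn0.
  + by case/negP: k3; apply/dvdzP; exists m%:Z; lia.
  + by right; exists m.
(* The lower end [- ver 1] cancels the [X] produced by the summand 1. *)
- exists (1 + \sum_(0 <= i < m) (ver (i * 3).+3 - ver (i * 3).+2)).
  rewrite mulrDr mulr1 mulr_sumr.
  have -> : \sum_(0 <= i < m) (1 + X) * (ver (i * 3).+3 - ver (i * 3).+2) =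
      \sum_(0 <= i < m) (ver (i.+1 * 3).+1 - ver (i * 3).+1).
    apply: eq_big_nat => i im; rewrite mulrBr !mulrDl !mul1r !verX_succ; try lia.
    by rewrite mulSn; ring.
  by rewrite telescope_sumr // (ver_gt (j := (m * 3).+1)); [ring | lia].
(* Here the lower end is [ver 0 = 1] itself. *)
- exists (\sum_(0 <= i < m.+1) (ver (i * 3).+1 - ver (i * 3).+2)).
  rewrite mulr_sumr.
  have -> : \sum_(0 <= i < m.+1) (1 + X) * (ver (i * 3).+1 - ver (i * 3).+2) =
      \sum_(0 <= i < m.+1) (- ver (i.+1 * 3) - - ver (i * 3)).
    apply: eq_big_nat => i im; rewrite mulrBr !mulrDl !mul1r !verX_succ; try lia.
    by rewrite mulSn; ring.
  by rewrite telescope_sumr // (ver_gt (j := (m.+1 * 3))); [rewrite ver0; ring | lia].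
Qed.

(** [pi_l] occurs in [pi_1 (x) pi_(l-1)], so each further factor reaches one more simple. *)
Lemma ver1X_gt0 n (l : 'I_k.+1) : (l <= n)%N -> 0 < ((1 + X) ^+ n) l.
Proof.
have nn1X : nonneg (1 + X).
  by rewrite -ver0 nonneg_add //; apply/forallP => i; rewrite verE.
have nnX : nonneg X by apply/forallP => i; rewrite verE.
elim: n l => [|n IHn] l ln.
  by rewrite expr0 -ver0 verE; lia.
have nn : nonneg ((1 + X) ^+ n) by exact: nonneg_exp.
rewrite exprS mulrDl mul1r ffunE.
have [ln'|ln'] := ltnP n l; last first.
  by rewrite ltr_pwDl ?IHn // (forallP (nonneg_mul nnX nn)).
rewrite ltr_wpDl ?(forallP nn) // fusion_mulE.
have l0 : (0 < l)%N by lia.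
have lk : (l.-1 < k.+1)%N by have := ltn_ord l; lia.
rewrite (bigD1 (inord 1 : 'I_k.+1)) //= ltr_pwDl //; last first.
  apply: sumr_ge0 => i _; apply: sumr_ge0 => j _.
  by rewrite !mulr_ge0 ?(forallP nnX) ?(forallP nn).
rewrite (bigD1 (Ordinal lk)) //= ltr_pwDl //; last first.
  by apply: sumr_ge0 => j _; rewrite !mulr_ge0 ?(forallP nnX) ?(forallP nn).
rewrite mulr_gt0 //; first by rewrite mulr_gt0 ?IHn //= ?verE ?inordK //; lia.
by rewrite /su2_fusion inordK // su2_admissibleE //=; have := ltn_ord l; lia.
Qed.

(** * Inversion of [2 (E + O) - 1] at even level *)

Section EvenLevel.
Variable n : nat.
Hypothesis kE : k = (2 * n)%N.

Definition even_ver : Ver k := \sum_(0 <= i < n.+1) ver i.*2.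
Definition odd_ver : Ver k := \sum_(0 <= i < n) ver i.*2.+1.

Local Notation E := even_ver.
Local Notation O := odd_ver.

Lemma verX_even : X * E = O *+ 2.
Proof.
rewrite /E big_nat_recl // mulrDr ver0 mulr1 mulr_sumr.
rewrite (eq_big_nat _ _ (F2 := fun i => ver i.*2.+1 + ver i.*2.+3)); last first.
  by move=> i im; rewrite doubleS verX_succ //; lia.
rewrite big_split /= addrCA mulr2n -/O; congr (_ + _).
(* [ver 1], coming from [pi_0], is the missing first term; the extra last term is [ver k.+1 = 0]. *)
transitivity (\sum_(0 <= i < n.+1) ver i.*2.+1); first by rewrite big_nat_recl.
by rewrite big_nat_recr //= (ver_gt (j := n.*2.+1)) ?addr0 //; lia.
Qed.

(** The lower neighbours of the odd simples miss [pi_k] among the even ones, the upper neighbours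
    miss [pi_0]. *)
Lemma verX_odd : X * O = E *+ 2 - 1 - g.
Proof.
rewrite mulr_sumr.
rewrite (eq_big_nat _ _ (F2 := fun i => ver i.*2 + ver i.*2.+2)); last first.
  by move=> i im; rewrite verX_succ //; lia.
rewrite big_split /= mulr2n {1}/E big_nat_recr //= /E big_nat_recl //=.
rewrite ver0 (_ : n.*2 = k); last lia.
by ring.
Qed.

(** As [k] is even, the reflection [j -> k - j] permutes the even indices. *)
Lemma ver_top_even : g * E = E.
Proof.
rewrite mulr_sumr [RHS]big_nat_rev /=; apply: eq_big_nat => i im.
by rewrite ver_topM; [congr ver; lia | lia].
Qed.

Lemma even_odd_ver_unit :
  ((E + O) *+ 2 - 1) * ((E - O) *+ 2 - 1) = 1.
Proof.
have EO : (E ^+ 2 - O ^+ 2) *+ 2 = E *+ 2.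
  (* [X * E * O] is evaluated in two ways; both bracketed differences vanish by the preceding
     relations. *)
  transitivity ((1 + g) * E - (X * O - (E *+ 2 - 1 - g)) * E + (X * E - O *+ 2) * O).
    by ring.
  by rewrite verX_odd verX_even !subrr mulrDl ver_top_even; ring.
transitivity (((E ^+ 2 - O ^+ 2) *+ 2 - E *+ 2) *+ 2 + 1); first by ring.
by rewrite EO; ring.
Qed.

Lemma sum_ver : \sum_(0 <= j < n.*2.+1) ver j = E + O.
Proof.
rewrite /E /O; elim: (n) => [|m IHm].
  by rewrite big_nat1 big_nat1 big_nil addr0.
rewrite doubleS big_nat_recr //= big_nat_recr //= {}IHm.
by rewrite [in RHS]big_nat_recr // [X in _ = _ + X]big_nat_recr //= doubleS; ring.
Qed.

End EvenLevel.

(** * Specialization of the isomorphism to SU(2) *)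

Lemma sigma_su2 (p : object (su2_rules k)) : sigma p = class p ^+ 2.
Proof.
by rewrite /sigma expr2; congr (class _ * _); apply/ffunP => i; rewrite ffunE.
Qed.

Lemma K0_isomorphic_Ver (R : realType) (d : {rmorphism Ver k -> R})
    (p : object (su2_rules k)) (u : Ver k) m :
  quantum_dimension d -> class p * u = 1 ->
  strictly_positive (class p ^+ m) ->
  ordered_ring_isomorphic (K0_pos (su2_rules k) p) (Ver_pos d).
Proof.
move=> dq pu p0; apply: (@K0_isomorphic_fusion_ring _ R d _ p (u ^+ 2) m).
- by move=> i; have := dq i (leq_ord i); rewrite /irr inord_val.
- by rewrite sigma_su2 -exprMn pu expr1n.
(* The square of a strictly positive element is strictly positive: [i (x) 1] contributes at [i]. *)
- rewrite sigma_su2 -exprM mulnC exprM => i.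
  rewrite expr2 fusion_mulE (bigD1 i) //= ltr_pwDl //; last first.
    by apply: sumr_ge0 => j _; apply: sumr_ge0 => l _; rewrite !mulr_ge0 ?(ltW (p0 _)).
  rewrite (bigD1 (ord0 : 'I_k.+1)) //= ltr_pwDl //; last first.
    by apply: sumr_ge0 => l _; rewrite !mulr_ge0 ?(ltW (p0 _)).
  rewrite !mulr_gt0 //.
  by rewrite su2_fusionC su2_fusion1 eqxx.
Qed.

End Verlinde.

Theorem mainTheorem4 (k : nat) (k_gt0 : (0 < k)%N) (R : realType)
    (d : {rmorphism Ver k -> R}) (d_qdim : quantum_dimension d) :
  [/\ ~~ (3 %| k%:Z - 1)%Z ->
        let p : object (su2_rules k) := irr 0 + irr 1 in
        ordered_ring_isomorphic (K0_pos (su2_rules k) p) (Ver_pos d),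
      forall n : nat, k = (2 * n)%N ->
        let p : object (su2_rules k) :=
          irr 0 + \sum_(1 <= j < (2 * n).+1) irr j *+ 2 in
        ordered_ring_isomorphic (K0_pos (su2_rules k) p) (Ver_pos d)
    & (~~ (3 %| k%:Z - 1)%Z \/ (2 %| k)%N) ->
        exists p : object (su2_rules k),
          ordered_ring_isomorphic (K0_pos (su2_rules k) p) (Ver_pos d)].
Proof.
have irrE j : (j <= k)%N -> class (irr j) = ver k j by rewrite /ver => ->.
have a : ~~ (3 %| k%:Z - 1)%Z -> ordered_ring_isomorphic
    (K0_pos (su2_rules k) (irr 0 + irr 1)) (Ver_pos d).
  move=> /(ver1_unit k_gt0)[y y1].
  have pE : class (irr 0 + irr 1) = 1 + ver k 1.
    by rewrite class_objectD !irrE // ver0.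
  (* All simples occur in the [k]-th power of [1 + pi_1]. *)
  apply: (@K0_isomorphic_Ver _ _ _ _ y k d_qdim); rewrite pE // => i.
  by apply: ver1X_gt0; rewrite ?leq_ord.
have b n : k = (2 * n)%N -> ordered_ring_isomorphic
    (K0_pos (su2_rules k) (irr 0 + \sum_(1 <= j < (2 * n).+1) irr j *+ 2))
    (Ver_pos d).
  move=> kE.
  have pE : class (irr 0 + \sum_(1 <= j < (2 * n).+1) irr j *+ 2) =
      1 + \sum_(1 <= j < (2 * n).+1) ver k j *+ 2.
    rewrite class_objectD irrE // ver0; congr (_ + _).
    rewrite (big_morph _ (@class_objectD _) (@class_object0 _)).
    by apply: eq_big_nat => j jk; rewrite mulr2n class_objectD irrE -?mulr2n //; lia.
  (* The exponent 1 suffices, since [pi] contains every simple. *)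
  apply: (@K0_isomorphic_Ver _ _ _ _ ((even_ver k n - odd_ver k n) *+ 2 - 1) 1 d_qdim).
    rewrite pE -[RHS](even_odd_ver_unit k_gt0 kE); congr (_ * _).
    (* Doubling the full sum counts the unit once too often, whence the [- 1]. *)
    by rewrite -sum_ver -mul2n [in RHS]big_ltn // ver0 sumrMnl; ring.
  move=> i; rewrite expr1 pE ffunE sum_ffunE -ver0 verE.
  have [i0|i0] := posnP i.
    rewrite ltr_pwDl ?i0 //; apply: sumr_ge0 => j _.
    by rewrite mulr2n ffunE verE.
  rewrite ltr_wpDl // (bigD1_seq (i : nat)) ?iota_uniq //=; last first.
    by rewrite mem_index_iota; have := ltn_ord i; lia.
  rewrite ltr_pwDl //; first by rewrite mulr2n ffunE verE eqxx.
  by apply: sumr_ge0 => j _; rewrite mulr2n ffunE verE.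
split=> // -[/a|/dvdnP[n]] h; first by eexists; exact: h.
by eexists; apply: (b n); rewrite mulnC.
Qed.
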